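(* Let $G=(V,E,s,t)$ be a directed multigraph with finite arc set $E$ and two distinguished vertices $s,t\in V$ (possibly equal). Let $k$ be a nonnegative integer. Assume that $G$ has at least $k$ (pairwise) disjoint quasi-cycles. Then the f-polynomials $f_{\mathcal{PM}(G)}(x)$ and $f_{\mathcal{PF}(G)}(x)$ are divisible by $(1+x)^k$ in $\mathbb{Z}[x]$.
   Context: Graphs are directed multigraphs; each arc has a source and a target in $V$; parallel arcs and self-loops are allowed. A walk from $v_0$ to $v_n$ is a sequence $(v_0,e_1,v_1,\ldots,e_n,v_n)$ with $n\ge 0$, $v_i\in V$, $e_i\in E$, where each $e_i$ is an arc from $v_{i-1}$ to $v_i$. A path is a walk that does not visit any vertex more than once; an $s-t$-path is a path from $s$ to $t$ (if $s=t$, this is the trivial path with no arcs). A cycle is a walk with $n\ge1$, $v_0=v_n$ and $v_0,\ldots,v_{n-1}$ distinct (so a self-loop gives a cycle). A useless arc is an arc that belongs to no $s-t$-path. A quasi-cycle of $G$ is a subset $F$ of $E$ that is either the set of arcs of a cycle of $G$ or a $1$-element set consisting of a single useless arc of $G$. A set $F\subseteq E$ contains a path if it contains every arc of it. The path-free and path-missing complexes are the simplicial complexes on ground set $E$ given by $\mathcal{PF}(G)=\{F\subseteq E : F \text{ contains no } s-t\text{-path}\}$ and $\mathcal{PM}(G)=\{F\subseteq E : E\setminus F \text{ contains an } s-t\text{-path}\}$. For a simplicial complex $\Delta$ (a set of subsets of a finite set closed under taking subsets, possibly empty), the f-polynomial is $f_\Delta(x)=\sum_{I\in\Delta}x^{\#I}\in\mathbb{Z}[x]$.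 *)

(* Defs.v *)
From HB Require Import structures.
From mathcomp Require Import all_boot all_order all_algebra.
From mathcomp Require Import boolp.

Set Implicit Arguments.
Unset Strict Implicit.
Unset Printing Implicit Defensive.

Import GRing.Theory.

(* The vertex set may be infinite; parallel arcs and self-loops are allowed. *)
Record multidigraph (V : eqType) (E : finType) := Multidigraph {
  source : E -> V;
  target : E -> V;
  s_vertex : V;
  t_vertex : V
}.

Section Graph.

Variables (V : eqType) (E : finType) (G : multidigraph V E).

(* A walk (v_0, e_1, v_1, ..., e_n, v_n) is encoded by v_0 and the sequence of
   its arcs e_1, ..., e_n, which determine its other vertices. *)
Fixpoint walk (u : V) (p : seq E) (v : V) : bool :=
  if p is e :: p' then (source G e == u) && walk (target G e) p' v else u == v.

(* v_1, ..., v_n *)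
Definition later_vertices (p : seq E) : seq V := map (target G) p.

Definition is_path (u : V) (p : seq E) (v : V) : bool :=
  walk u p v && uniq (u :: later_vertices p).

Definition st_path (p : seq E) : bool := is_path (s_vertex G) p (t_vertex G).

(* [belast u (later_vertices p)] is v_0, ..., v_{n-1}. *)
Definition is_cycle (u : V) (p : seq E) : bool :=
  [&& 0 < size p, walk u p u & uniq (belast u (later_vertices p))].

Definition useless (e : E) : Prop := ~ exists2 p, st_path p & e \in p.

Definition quasi_cycle (F : {set E}) : Prop :=
  (exists u p, is_cycle u p /\ F = [set e in p]) \/
  (exists2 e, useless e & F = [set e]).

Definition contains_st_path (F : {set E}) : Prop :=
  exists2 p, st_path p & {subset p <= F}.

End Graph.

(* Possibly without faces, not even the empty one. *)
Record simplicial_complex (E : finType) := SimplicialComplex {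
  faces : {set {set E}};
  faces_closed : forall I J : {set E}, J \in faces -> I \subset J -> I \in faces
}.

Definition f_poly (E : finType) (D : simplicial_complex E) : {poly int} :=
  (\sum_(I in faces D) 'X ^+ #|I|)%R.

Section Complexes.

Variables (V : eqType) (E : finType) (G : multidigraph V E).

Definition PF_faces : {set {set E}} :=
  [set F : {set E} | `[< ~ contains_st_path G F >]].

Definition PM_faces : {set {set E}} :=
  [set F : {set E} | `[< contains_st_path G (~: F) >]].

Lemma PF_closed (I J : {set E}) :
  J \in PF_faces -> I \subset J -> I \in PF_faces.
Proof.
rewrite !inE => /asboolP nJ /subsetP IJ; apply/asboolP => -[p pP pI].
by apply: nJ; exists p => // e /pI /IJ.
Qed.

Lemma PM_closed (I J : {set E}) :
  J \in PM_faces -> I \subset J -> I \in PM_faces.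
Proof.
rewrite !inE -setCS => /asboolP[p pP pJ] /subsetP JI; apply/asboolP.
by exists p => // e /pJ /JI.
Qed.

Definition PF : simplicial_complex E := SimplicialComplex PF_closed.

Definition PM : simplicial_complex E := SimplicialComplex PM_closed.

End Complexes.

(* Main.v *)
Require Import Defs.
From mathcomp Require Import all_boot all_order all_algebra.
From mathcomp Require Import boolp ring.

(** Explore the graph from a growing set [S] of source vertices, with [R] the
    set of arcs not yet examined.  Examining an arc [e] from [S] to a vertex
    [v] outside [S] splits the enumerator of the arc sets joining [S] to [t]
    into a part for [S] (deletion of [e]) and a part for [v :: S] (contraction
    of [e]).  Irrelevant arcs stay irrelevant in both parts, and a cycle
    through [e] must come back into [S] by another arc, which is irrelevant
    since it ends in [S].  So every quasi-cycle leaves a cycle or an irrelevant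
    arc among the unexamined arcs until one of its irrelevant arcs is examined,
    and examining an irrelevant arc gives a factor [a + b], that is [1 + x]. *)

Set Implicit Arguments.
Unset Strict Implicit.
Unset Printing Implicit Defensive.

Import GRing.Theory.

(** * Two-weight enumerators of families of arc sets *)

Section Enumerator.

Variables (E : finType) (K : comPzRingType) (a b : K).
Implicit Types (R A : {set E}) (h : {set E} -> bool).

(** Two weights let one divisibility result serve both complexes: [(a, b)] is [(1, 'X)] for PM and
    [('X, 1)] for PF, and both times [a + b] is the desired factor. *)
Definition enumerator R h : K :=
  (\sum_(A : {set E} | (A \subset R) && h A) a ^+ #|A| * b ^+ #|R :\: A|)%R.

Lemma eq_enumerator R h h' :
  (forall A, A \subset R -> h A = h' A) -> enumerator R h = enumerator R h'.
Proof.
move=> hh'; apply: eq_bigl => A.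
by have [/hh' ->|//] := boolP (A \subset R).
Qed.

Lemma enumerator_split R h e : e \in R ->
  (enumerator R h = b * enumerator (R :\ e) h
     + a * enumerator (R :\ e) (fun A => h (e |: A)))%R.
Proof.
move=> eR; rewrite /enumerator (bigID (fun A : {set E} => e \notin A)) /=.
congr (_ + _)%R; rewrite big_distrr /=.
  apply: eq_big => [A|A /andP[/andP[AR _] eA]].
    by rewrite subsetD1; do !case: (_ \in _) => //=; rewrite ?andbT ?andbF.
  rewrite setDDl setUC -setDDl (cardsD1 e (R :\: A)) !inE eA eR /= exprS.
  by rewrite mulrCA.
rewrite (reindex_onto (fun A => e |: A) (fun A => A :\ e)) /=; last first.
  by move=> A /andP[_]; rewrite negbK => eA; rewrite setD1K.
apply: eq_big => [A|A].
  rewrite subUset sub1set eR setU11 /= andbT subsetD1.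
  have [eA|eA] := boolP (e \in A).
    rewrite andbF /=; apply/negbTE/negP => /andP[_ /eqP AE].
    by have := setD11 e (e |: A); rewrite AE eA.
  by rewrite setU1K // eqxx andbT andbT.
move=> /andP[_ /eqP AE].
have eA : e \notin A by rewrite -AE setD11.
by rewrite cardsU1 eA add1n exprS mulrA -setDDl.
Qed.

End Enumerator.

(** * Walks, and reachability of the target vertex *)

Section Walks.

Variables (V : eqType) (E : finType) (G : multidigraph V E).
Implicit Types (S : seq V) (R A F : {set E}) (p q : seq E).

Lemma walk_cat u p e q v :
  walk G u (p ++ e :: q) v = walk G u p (source G e) && walk G (target G e) q v.
Proof.
elim: p u => [|f p IH] u /=; last by rewrite IH andbA.
by rewrite [u == _]eq_sym.
Qed.

Lemma walk_mem_closed S u p v :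
  (forall e, e \in p -> target G e \in S -> source G e \in S) ->
  walk G u p v -> v \in S -> u \in S.
Proof.
elim: p u => [|e p IH] u /= H; first by move/eqP->.
case/andP=> /eqP <- w vS; apply: (H e); first exact: mem_head.
by apply: IH w vS => f fp; apply: H; rewrite inE fp orbT.
Qed.

(** If no arc of [p] entered [S] from outside, membership in [S] would pass backwards along the
    walk: from the source of [e] to [u], then from [u], as end of the walk, to the target of [e]. *)
Lemma closed_walk_reenters S u p e : walk G u p u -> e \in p ->
  source G e \in S -> target G e \notin S ->
  exists2 f, f \in p & (target G f \in S) && (source G f \notin S).
Proof.
move=> w ep; case/splitPr: ep w => p1 p2; rewrite walk_cat => /andP[w1 w2] sS tS.
case: (boolP (has (fun f => (target G f \in S) && (source G f \notin S))
  (p1 ++ e :: p2))) => [/hasP //|/hasPn H].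
have cl f : f \in p1 ++ e :: p2 -> target G f \in S -> source G f \in S.
  by move/H; rewrite negb_and negbK => /orP[/negP|].
case/negP: tS; apply: (walk_mem_closed _ w2).
  by move=> f fp; apply: cl; rewrite mem_cat inE fp !orbT.
by apply: (walk_mem_closed _ w1) => // f fp; apply: cl; rewrite mem_cat fp.
Qed.

Lemma path_suffix w q v u : is_path G w q v -> u \in w :: later_vertices G q ->
  exists2 q', is_path G u q' v & {subset q' <= q}.
Proof.
elim: q w => [|e q IH] w; rewrite inE => P.
  by rewrite orbF => /eqP ->; exists [::].
case/orP=> [/eqP ->|]; first by exists (e :: q).
move: P; rewrite /is_path /= => /andP[/andP[_ wq] /andP[_ uq]] /IH[].
  by rewrite /is_path wq.
by move=> q' P' sub; exists q' => // f /sub fq; rewrite inE fq orbT.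
Qed.

Lemma walk_path u p v : walk G u p v ->
  exists2 q, is_path G u q v & {subset q <= p}.
Proof.
elim: p u => [|e p IH] u /=; first by exists [::] => //; rewrite /is_path /= andbT.
case/andP=> /eqP se /IH[q P sub].
(* If the path returns to [u], only its part from there on is kept. *)
have [uq|uq] := boolP (u \in target G e :: later_vertices G q).
  have [q' P' sub'] := path_suffix P uq.
  by exists q' => // f /sub' /sub fp; rewrite inE fp orbT.
exists (e :: q); last first.
  by move=> f; rewrite !inE => /orP[->//|/sub ->]; rewrite orbT.
by move: P uq; rewrite /is_path /= se eqxx /= => /andP[-> ->] ->.
Qed.

(** Walks, unlike paths, can be cut and glued freely. Several sources are allowed because
    contracting an arc that starts in [S] amounts to adding its target to [S]. *)
Definition reaches S A : Prop :=
  exists u p, [/\ u \in S, walk G u p (t_vertex G) & {subset p <= A}].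

Definition reachesb S A : bool := `[< reaches S A >].

Lemma reaches_sub S S' A A' : {subset S <= S'} -> A \subset A' ->
  reaches S A -> reaches S' A'.
Proof.
move=> SS' /subsetP AA' [u [p [uS w pA]]].
by exists u, p; split=> [||f /pA /AA'] //; apply: SS'.
Qed.

Lemma reaches_source A : reaches [:: s_vertex G] A <-> contains_st_path G A.
Proof.
split=> [[u [p [+ w pA]]]|[p /andP[w _] pA]]; last first.
  by exists (s_vertex G), p; rewrite mem_head.
rewrite inE => /eqP us; have [q P sub] := walk_path w.
by exists q => [|f /sub /pA]; rewrite // /st_path -us.
Qed.

(* Only the part of the walk after the last passage through [e] is kept. *)
Lemma reaches_setU1 S A e : reaches S (e |: A) -> reaches (target G e :: S) A.
Proof.
case=> u [p [uS w pA]].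
suff [[q wq qA]|[q wq qA]] : (exists2 q, walk G u q (t_vertex G) & {subset q <= A})
  \/ (exists2 q, walk G (target G e) q (t_vertex G) & {subset q <= A}).
- by exists u, q; rewrite inE uS orbT.
- by exists (target G e), q; rewrite mem_head.
elim: p u {uS} w pA => [|f p IH] u /= w pA; first by left; exists [::].
case/andP: w => /eqP sf w; have /setU1P fA := pA f (mem_head _ _).
have /(IH _ w)[[q wq qA]|] : {subset p <= e |: A}; last by right.
  by move=> g gp; apply: pA; rewrite inE gp orbT.
case: fA => [fe|fA]; first by right; exists q; rewrite // -fe.
left; exists (f :: q); first by rewrite /= sf eqxx.
by move=> g; rewrite inE => /orP[/eqP ->|/qA].
Qed.

Lemma reachesb_contract S A e : source G e \in S ->
  reachesb S (e |: A) = reachesb (target G e :: S) A.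
Proof.
move=> eS; apply: asbool_equiv_eq; split; first exact: reaches_setU1.
case=> u [p [+ w pA]]; rewrite inE => /orP[/eqP ue|uS]; last first.
  by exists u, p; split=> // f /pA fA; apply: setU1r.
exists (source G e), (e :: p); split=> //=; first by rewrite eqxx -ue.
by move=> f; rewrite inE => /orP[/eqP ->|/pA]; [apply: setU11|apply: setU1r].
Qed.

(** * Irrelevant arcs *)

Definition irrelevant S R e :=
  forall A, A \subset R -> reachesb S (e |: A) = reachesb S A.

Lemma irrelevant_sub S R R' e : R' \subset R -> irrelevant S R e ->
  irrelevant S R' e.
Proof. by move=> R'R I A /subset_trans /(_ R'R) /I. Qed.

(** Undoing the contraction turns [A] into [e |: A], which is still a subset of [R]. *)
Lemma irrelevant_contract S R e f : e \in R -> source G e \in S ->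
  irrelevant S R f -> irrelevant (target G e :: S) (R :\ e) f.
Proof.
move=> eR eS I A AR; rewrite -!reachesb_contract // setUCA I //.
by rewrite subUset sub1set eR (subset_trans AR (subsetDl _ _)).
Qed.

Lemma irrelevantP S R e :
  (forall A, A \subset R -> reaches S (e |: A) -> reaches S A) ->
  irrelevant S R e.
Proof.
move=> I A AR; apply: asbool_equiv_eq; split; first exact: I.
by apply: reaches_sub => //; apply: subsetUr.
Qed.

Lemma irrelevant_target S R e : target G e \in S -> irrelevant S R e.
Proof.
move=> eS; apply: irrelevantP => A _ /reaches_setU1.
by apply: reaches_sub => // u; rewrite inE => /orP[/eqP ->|].
Qed.

Lemma irrelevant_useless R e : useless G e ->
  irrelevant [:: s_vertex G] R e.
Proof.
move=> eU; apply: irrelevantP => A _ /reaches_source[p P pA].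
apply/reaches_source; exists p => // f fp.
by case/setU1P: (pA f fp) => // fe; case: eU; exists p; rewrite -?fe.
Qed.

(** A walk in [R] from [S] can never leave [S], so if it ends at [t], then [t] is in [S] and the
    trivial walk does as well. *)
Lemma irrelevant_closed S R e : e \in R ->
  (forall f, f \in R -> source G f \in S -> target G f \in S) ->
  irrelevant S R e.
Proof.
move=> eR cl; apply: irrelevantP => A AR [u [p [uS w pA]]].
have {pA}pR f : f \in p -> f \in R.
  by move/pA/setU1P => [->|/(subsetP AR)].
exists (t_vertex G), [::]; split=> //=.
elim: p u uS w pR => [|f p IH] u uS /=; first by move/eqP<-.
case/andP=> /eqP fu w pR; apply: IH w _ => [|g gp].
  by apply: cl; rewrite ?fu ?pR ?mem_head.
by apply: pR; rewrite inE gp orbT.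
Qed.

(** The invariant kept for each quasi-cycle [F] during the exploration; the closed walk stands for a
    cycle none of whose arcs has been examined. *)
Definition redundant S R F :=
  (exists u p, [/\ 0 < size p, walk G u p u & {subset p <= F :&: R}]) \/
  (exists2 e, e \in F :&: R & irrelevant S R e).

Lemma quasi_cycle_redundant F :
  quasi_cycle G F -> redundant [:: s_vertex G] setT F.
Proof.
case=> [[u [p [/and3P[p0 w _] ->]]]|[e eU ->]]; [left|right].
  by exists u, p; split=> // f; rewrite !inE andbT.
by exists e; [rewrite !inE eqxx|apply: irrelevant_useless].
Qed.

Lemma redundant_notin S R F e : e \notin F -> redundant S R F ->
  redundant S (R :\ e) F.
Proof.
move=> eF [[u [p [p0 w pF]]]|[f /setIP[fF fR] I]]; [left|right].
  exists u, p; split=> // f /pF /setIP[fF fR]; rewrite !inE fF fR !andbT /=.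
  by apply: contraNneq eF => <-.
exists f; last exact: irrelevant_sub (subsetDl _ _) I.
by rewrite !inE fF fR !andbT /=; apply: contraNneq eF => <-.
Qed.

(** [S' = S] serves the deletion of [e], and [S' = target G e :: S] its contraction. The irrelevant
    arc found must differ from [e]: either [e] itself is not irrelevant, or the arc found ends in
    [S] while [e] does not. *)
Lemma redundant_examine S S' R F e : {subset S <= S'} ->
  source G e \in S -> target G e \notin S -> ~ irrelevant S R e ->
  (forall f, irrelevant S R f -> irrelevant S' (R :\ e) f) ->
  redundant S R F -> redundant S' (R :\ e) F.
Proof.
move=> SS' eS eS' eI mono [[u [p [p0 w pF]]]|[f /setIP[fF fR] I]]; last first.
  right; exists f; last exact: mono.
  by rewrite !inE fF fR !andbT /=; apply/eqP => fe; apply: eI; rewrite -fe.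
have [ep|ep] := boolP (e \in p); last first.
  left; exists u, p; split=> // f fp; have /setIP[fF fR] := pF f fp.
  by rewrite !inE fF fR !andbT /=; apply: contraNneq ep => <-.
have [f fp /andP[fS _]] := closed_walk_reenters w ep eS eS'.
right; exists f; last by apply: irrelevant_target; apply: SS'.
have /setIP[fF fR] := pF f fp.
by rewrite !inE fF fR !andbT /=; apply: contraNneq eS' => <-.
Qed.

Lemma redundant_set0 S F : ~ redundant S set0 F.
Proof.
case=> [[u [[|e p] [//= _ _ pF]]]|[e]]; last by rewrite !inE andbF.
by have := pF e (mem_head _ _); rewrite !inE andbF.
Qed.

(* With [c = true] this is about PM, with [c = false] about PF. *)
Lemma enumerator_dvd (K : comPzRingType) (a b : K) (c : bool) S R
    (P : {set {set E}}) k :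
  k <= #|P| -> trivIset P -> (forall F, F \in P -> redundant S R F) ->
  exists q : K, enumerator a b R (fun A => reachesb S A == c) = (q * (a + b) ^+ k)%R.
Proof.
have [n] := ubnP #|R|; elim: n S R P k => // n IH S R P k Rn kP tP redP.
have [k0|k0] := posnP k.
  by rewrite k0; exists (enumerator a b R (fun A => reachesb S A == c));
    rewrite expr0 mulr1.
have Rn' e : e \in R -> #|R :\ e| < n.
  by move=> eR; move: Rn; rewrite (cardsD1 e) eR ltnS.
have [[e eR eI]|noI] := pselect (exists2 e, e \in R & irrelevant S R e).
  (* By disjointness at most one member of [P] contains [e]; discarding it costs one power, which
     the factor [a + b] from [e] restores. *)
  pose P' := P :\: [set F : {set E} | e \in F].
  have kP' : k.-1 <= #|P'|.
    have : #|P :&: [set F : {set E} | e \in F]| <= 1.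
      apply/card_le1_eqP => A B /setIP[AP]; rewrite inE => eA /setIP[BP].
      rewrite inE => eB; apply/eqP/negPn/negP => AB.
      have /disjointFr := trivIsetP tP _ _ BP AP AB.
      by move/(_ e eB); rewrite eA.
    move: kP; rewrite -(cardsID [set F : {set E} | e \in F] P) -/P' -(prednK k0) => le le1.
    by move: (leq_trans le (leq_add le1 (leqnn _))); rewrite add1n ltnS.
  have tP' : trivIset P' by apply: trivIsetS tP; apply: subsetDl.
  have [F|q qE] := IH S (R :\ e) P' k.-1 (Rn' e eR) kP' tP'.
    by rewrite !inE => /andP[eF /redP]; apply: redundant_notin.
  exists q; rewrite (enumerator_split _ _ _ eR).
  (* As [e] is irrelevant, deletion and contraction leave the same enumerator. *)
  rewrite [X in (_ + a * X)%R](@eq_enumerator _ _ _ _ _ _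
    (fun A => reachesb S A == c)).
    by rewrite qE -[in RHS](prednK k0) exprS; ring.
  by move=> A /subset_trans/(_ (subsetDl _ _))/eI ->.
have [e eR /andP[eS eT]] :
    exists2 e, e \in R & (source G e \in S) && (target G e \notin S).
  have [/existsP[e /andP[eR eST]]|none] :=
    boolP [exists e, (e \in R) && ((source G e \in S) && (target G e \notin S))].
    by exists e.
  (* If no arc of [R] leaves [S], all arcs of [R] are irrelevant. There is at least one, since
     [k > 0] provides a member of [P], redundant in [R]. *)
  have [R0|[e eR]] := set_0Vmem R.
    have /card_gt0P[F /redP] : 0 < #|P| by apply: leq_trans kP.
    by rewrite R0 => /redundant_set0.
  case: noI; exists e => //; apply: irrelevant_closed => // f fR fS.
  by apply: contraNT none => fT; apply/existsP; exists f; rewrite fR fS fT.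
have eI : ~ irrelevant S R e by move=> I; apply: noI; exists e.
(* All of [P] survives in both parts, so each is divisible by the full power. *)
have [F FP|q1 E1] := IH S (R :\ e) P k (Rn' e eR) kP tP.
  apply: redundant_examine (redP F FP) => // f.
  exact/irrelevant_sub/subsetDl.
have [F FP|q2 E2] := IH (target G e :: S) (R :\ e) P k (Rn' e eR) kP tP.
  apply: redundant_examine (redP F FP) => // [u uS|f].
    by rewrite inE uS orbT.
  exact: irrelevant_contract.
exists (b * q1 + a * q2)%R; rewrite (enumerator_split _ _ _ eR) E1.
rewrite [X in (_ + a * X)%R](@eq_enumerator _ _ _ _ _ _
  (fun A => reachesb (target G e :: S) A == c)); first by rewrite E2; ring.
by move=> A _; rewrite reachesb_contract.
Qed.

(** * The f-polynomials as enumerators *)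

Lemma f_poly_PM : f_poly (PM G) =
  enumerator 1%R 'X%R [set: E] (fun A => reachesb [:: s_vertex G] A == true).
Proof.
(* A face of PM is the complement of an arc set joining [s] to [t], so the missing arcs carry the
   weight ['X]. *)
rewrite /enumerator (reindex_inj (inv_inj (@setCK E))) /=.
apply: eq_big => [A|A _]; last by rewrite expr1n mul1r setTD setCK.
by rewrite inE subsetT /= eqb_id; apply: asbool_equiv_eq; rewrite reaches_source.
Qed.

Lemma f_poly_PF : f_poly (PF G) =
  enumerator 'X%R 1%R [set: E] (fun A => reachesb [:: s_vertex G] A == false).
Proof.
rewrite /enumerator; apply: eq_big => [A|A _]; last by rewrite expr1n mulr1.
rewrite inE subsetT /= eqbF_neg -asbool_neg; apply: asbool_equiv_eq.
by rewrite reaches_source.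
Qed.

End Walks.

Theorem theorem1p8 (V : eqType) (E : finType) (G : multidigraph V E) (k : nat)
    (Hk : exists P : {set {set E}},
        [/\ k <= #|P|, trivIset P & forall F, F \in P -> quasi_cycle G F]) :
  (exists q : {poly int}, f_poly (PM G) = q * (1 + 'X) ^+ k)%R /\
  (exists q : {poly int}, f_poly (PF G) = q * (1 + 'X) ^+ k)%R.
Proof.
case: Hk => P [kP tP qP].
have red F : F \in P -> redundant G [:: s_vertex G] setT F.
  by move/qP; apply: quasi_cycle_redundant.
rewrite f_poly_PM f_poly_PF; split; first exact: enumerator_dvd kP tP red.
by rewrite addrC; apply: enumerator_dvd kP tP red.
Qed.
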